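(* Let $f\in\mathcal{C}(I\times J,\mathbb{R})$, let $L:\mathcal{C}(I\times J,\mathbb{R})\to\mathcal{C}(I\times J,\mathbb{R})$ be a bounded linear operator with $Lf\neq f$ and $(Lf)(x_i,y_j)=f(x_i,y_j)$ for all $(i,j)\in\{0,N\}\times\{0,M\}$, and let $\alpha:I\times J\to\mathbb{R}$ be continuous with $\|\alpha\|_\infty<1$. For $1\le i\le N$, $1\le j\le M$ define $F_{ij}:I\times J\times\mathbb{R}\to\mathbb{R}$ by $$F_{ij}(x,y,z)=\alpha\big(u_i(x),v_j(y)\big)z+f\big(u_i(x),v_j(y)\big)-\alpha\big(u_i(x),v_j(y)\big)(Lf)(x,y)$$ and $W_{ij}:I\times J\times\mathbb{R}\to I_i\times J_j\times\mathbb{R}$ by $W_{ij}(x,y,z)=\big(u_i(x),v_j(y),F_{ij}(x,y,z)\big)$. Then there exists a unique continuous function $f^{\alpha}_{\Delta,L}:I\times J\to\mathbb{R}$ such that $f^{\alpha}_{\Delta,L}(x_i,y_j)=f(x_i,y_j)$ for all $0\le i\le N$, $0\le j\le M$, and $G=\bigcup_{1\le i\le N,\,1\le j\le M}W_{ij}(G)$, where $G=\{(x,y,f^{\alpha}_{\Delta,L}(x,y)):(x,y)\in I\times J\}$ is the graph of $f^{\alpha}_{\Delta,L}$.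
   Context: Let $I=[x_0,x_N]$, $J=[y_0,y_M]$ and let $\Delta$ be a net $x_0<x_1<\dots<x_N$, $y_0<y_1<\dots<y_M$, with $N,M$ such that the maps below are contractive (i.e. $N,M\ge 2$). Put $I_i=[x_{i-1},x_i]$ and $J_j=[y_{j-1},y_j]$. For $1\le i\le N$, $u_i:I\to I_i$, $u_i(x)=a_ix+b_i$, is the affine bijection with $u_i(x_0)=x_{i-1}$, $u_i(x_N)=x_i$ if $i$ is odd, and $u_i(x_0)=x_i$, $u_i(x_N)=x_{i-1}$ if $i$ is even. For $1\le j\le M$, $v_j:J\to J_j$, $v_j(y)=c_jy+d_j$, is the affine bijection with $v_j(y_0)=y_{j-1}$, $v_j(y_M)=y_j$ if $j$ is odd, and $v_j(y_0)=y_j$, $v_j(y_M)=y_{j-1}$ if $j$ is even. $\mathcal{C}(I\times J,\mathbb{R})$ is the Banach space of continuous real functions on $I\times J$ with the uniform norm $\|\cdot\|_\infty$. *)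

(* Defs.v *)
From HB Require Import structures.
From mathcomp Require Import all_boot all_order all_algebra.
From mathcomp Require Import all_classical all_reals all_analysis.
From mathcomp Require Import ring lra.

Set Implicit Arguments.
Unset Strict Implicit.
Unset Printing Implicit Defensive.

Import Order.TTheory GRing.Theory Num.Theory.
Import numFieldNormedType.Exports.

Local Open Scope classical_set_scope.
Local Open Scope ring_scope.

Definition rect (R : realType) (a b c d : R) : set (R * R) :=
  `[a, b] `*` `[c, d].

Lemma rect_compact (R : realType) (a b c d : R) : compact (rect a b c d).
Proof. by apply: compact_setX; exact: segment_compact. Qed.

(* A continuous function on the rectangle is represented by its extension by 0
   to the plane.  Thus each continuous function on the rectangle has exactly one
   representative, equality of representatives is equality on the rectangle, and
   f (u, v) needs no proof that (u, v) lies in the rectangle. *)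
Definition rect_cont (R : realType) (a b c d : R) : {pred R * R -> R} :=
  mem [set f : R * R -> R | {within rect a b c d, continuous f} /\
                            forall p, ~ rect a b c d p -> f p = 0].

Record Crectangle (R : realType) (a b c d : R) : Type := MkCrectangle {
  Crectangle_fun :> R * R -> R;
  Crectangle_funP : Crectangle_fun \in rect_cont a b c d
}.

Section Crectangle_normed.
Context {R : realType} (a b c d : R).
Local Notation K := (rect a b c d).
Local Notation C := (Crectangle a b c d).

HB.instance Definition _ := [isSub of C for @Crectangle_fun R a b c d].
HB.instance Definition _ := [Choice of C by <:].

Lemma rect_contP (f : R * R -> R) :
  f \in rect_cont a b c d <->
  {within K, continuous f} /\ forall p, ~ K p -> f p = 0.
Proof. by split; [move/set_mem|move=> ?; apply/mem_set]. Qed.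

Lemma Crectangle_cont (f : C) : {within K, continuous f}.
Proof. by have /rect_contP[] := Crectangle_funP f. Qed.

Lemma Crectangle_out (f : C) p : ~ K p -> f p = 0.
Proof. by have /rect_contP[_] := Crectangle_funP f; apply. Qed.

Lemma CrectangleP (f g : C) : (forall p, K p -> f p = g p) -> f = g.
Proof.
move=> fg; apply/val_inj/funext => p /=.
have [/fg//|Kp] := pselect (K p).
by rewrite !Crectangle_out.
Qed.

Lemma rect_cont_submod_closed : submod_closed (rect_cont a b c d).
Proof.
split.
  by apply/rect_contP; split => // x; exact: cvg_cst.
move=> r f g /rect_contP[cf f0] /rect_contP[cg g0]; apply/rect_contP; split.
  move=> x; apply: cvgD; last exact: cg.
  by apply: cvgM; [exact: cvg_cst|exact: cf].
by move=> p Kp; rewrite /= !fctE f0// g0// scaler0 addr0.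
Qed.

HB.instance Definition _ := GRing.isSubmodClosed.Build _ _ (rect_cont a b c d)
  rect_cont_submod_closed.
HB.instance Definition _ := [SubChoice_isSubLmodule of C by <:].

Lemma CrectangleD (f g : C) p : (f + g) p = f p + g p.
Proof. by []. Qed.

Lemma CrectangleZ (k : R) (f : C) p : (k *: f) p = k * f p.
Proof. by []. Qed.

Definition Crectangle_norm (f : C) : R := sup [set `|f p| | p in K].

Lemma Crectangle_norm_has_ub (f : C) : has_ubound [set `|f p| | p in K].
Proof.
have /compact_bounded[M [_ fM]] :=
  continuous_compact (@Crectangle_cont f) (@rect_compact R a b c d).
exists (M + 1) => _ [p Kp <-]; apply: fM; first by rewrite ltrDl.
by exists p.
Qed.

Lemma Crectangle_norm_ge (f : C) p : `|f p| <= Crectangle_norm f.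
Proof.
have [Kp|Kp] := pselect (K p).
  by apply: ub_le_sup; [exact: Crectangle_norm_has_ub|exists p].
rewrite Crectangle_out// normr0.
have [[q Kq]|] := pselect (K !=set0); last first.
  by move/set0P/negP; rewrite negbK /Crectangle_norm => /eqP ->; rewrite image_set0 sup0.
apply: (le_trans (normr_ge0 (f q))).
by apply: ub_le_sup; [exact: Crectangle_norm_has_ub|exists q].
Qed.

Lemma Crectangle_norm_le (f : C) r :
  0 <= r -> (forall p, K p -> `|f p| <= r) -> Crectangle_norm f <= r.
Proof.
move=> r0 fr; have [[q Kq]|] := pselect (K !=set0); last first.
  by move/set0P/negP; rewrite negbK /Crectangle_norm => /eqP ->; rewrite image_set0 sup0.
apply: ge_sup; first by exists `|f q|, q.
by move=> _ [p Kp <-]; exact: fr.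
Qed.

Let Crectangle_norm_ge0 (f : C) : 0 <= Crectangle_norm f.
Proof. exact: le_trans (normr_ge0 _) (Crectangle_norm_ge f 0). Qed.

Let ler_Crectangle_normD (f g : C) :
  Crectangle_norm (f + g) <= Crectangle_norm f + Crectangle_norm g.
Proof.
apply: Crectangle_norm_le => [|p _]; first exact: addr_ge0.
by rewrite CrectangleD (le_trans (ler_normD _ _))// lerD// Crectangle_norm_ge.
Qed.

Let Crectangle_normZ (k : R) (f : C) : Crectangle_norm (k *: f) = `|k| * Crectangle_norm f.
Proof.
have le l (g : C) : Crectangle_norm (l *: g) <= `|l| * Crectangle_norm g.
  apply: Crectangle_norm_le => [|p _]; first exact: mulr_ge0.
  by rewrite CrectangleZ normrM ler_wpM2l// Crectangle_norm_ge.
apply/eqP; rewrite eq_le le/=.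
have [->|k0] := eqVneq k 0; first by rewrite normr0 mul0r.
rewrite -ler_pdivlMl ?normr_gt0// -normfV.
by rewrite -{1}[f](scalerK k0) le.
Qed.

Let Crectangle_norm_eq0 (f : C) : Crectangle_norm f = 0 -> f = 0.
Proof.
move=> f0; apply: CrectangleP => p _; apply/eqP.
by rewrite -normr_le0 -f0 Crectangle_norm_ge.
Qed.

HB.instance Definition _ := Lmodule_isNormed.Build R C
  ler_Crectangle_normD Crectangle_normZ Crectangle_norm_eq0.

Lemma Crectangle_normE (f : C) : `|f| = sup [set `|f p| | p in K].
Proof. by []. Qed.

Let Crectangle_complete (F : set_system C) : ProperFilter F -> cauchy F -> cvg F.
Proof.
move=> FF /cauchy_ballP Fc.
have FC (e : R) : 0 < e -> \forall g & h \near F, `|g - h| < e.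
  by move=> e0; have := Fc e e0; rewrite -ball_normE.
have Fp (p : R * R) : cvg ((fun g : C => g p) @ F).
  apply/cauchy_cvgP/cauchy_ballP => e e0; near_simpl.
  rewrite -ball_normE.
  have := FC e e0; apply: filterS => -[g h] /= gh.
  exact: le_lt_trans (Crectangle_norm_ge (g - h) p) gh.
pose l p : R := lim ((fun g : C => g p) @ F).
have lE (e : R) : 0 < e -> \forall g \near F, forall p, `|(g : C) p - l p| <= e.
  move=> e0; have [[A B] /= [FA FB] AB] := FC e e0.
  apply: filterS (FA) => g Ag p.
  have cl : (fun h : C => `|g p - h p|) @ F --> `|g p - l p|.
    by apply: cvg_norm; apply: cvgB; [exact: cvg_cst|exact: Fp].
  apply: (closed_cvg (fun x => x <= e) _ _ _ cl); first exact: closed_le.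
  apply: filterS FB => h Bh.
  exact/ltW/(le_lt_trans (Crectangle_norm_ge (g - h) p))/(AB (g, h)).
have lK : l \in rect_cont a b c d.
  apply/rect_contP; split => [x|p Kp].
    apply/cvgrPdist_lt => e e0.
    have e3 : 0 < e / 3 by rewrite divr_gt0.
    have [g gl] := filter_ex (lE _ e3).
    have /cvgrPdist_lt/(_ _ e3) := Crectangle_cont (f := g) (x := x).
    apply: filterS => z gz.
    have -> : l x - l z = - (g x - l x) + (g x - g z) + (g z - l z).
      by rewrite opprB -!addrA (addrC (g x)) -!addrA; lra.
    rewrite [e](_ : _ = e / 3 + e / 3 + e / 3); last by lra.
    rewrite (le_lt_trans (ler_normD _ _))// ltr_leD//.
    by rewrite (le_lt_trans (ler_normD _ _))// ler_ltD// normrN.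
  apply: cvg_lim => //; rewrite (_ : (fun _ => _) = cst 0); first exact: cvg_cst.
  by apply/funext => g; rewrite Crectangle_out.
apply/cvg_ex; exists (MkCrectangle lK); apply/fcvgrPdist_lt => e e0.
have e2 : 0 < e / 2 by rewrite divr_gt0.
apply: filterS (lE _ e2) => g gl.
apply: (@le_lt_trans _ _ (e / 2)); last by lra.
apply: Crectangle_norm_le => [|p _]; first exact: ltW.
by rewrite distrC; exact: gl.
Qed.

HB.instance Definition _ := Uniform_isComplete.Build C Crectangle_complete.

End Crectangle_normed.

Section net_map.
Context {R : realType}.
Implicit Types (t : nat -> R) (n i : nat) (s : R).

Definition net_first t i : R := if odd i then t i.-1 else t i.
Definition net_last t i : R := if odd i then t i else t i.-1.

(* For a net t 0 < ... < t n and 1 <= i <= n, net_map t n i is the affine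
   bijection from [t 0, t n] to [t i.-1, t i], increasing for odd i and
   decreasing for even i; net_first and net_last are the images of t 0, t n. *)
Definition net_slope t n i : R := (net_last t i - net_first t i) / (t n - t 0%N).
Definition net_intercept t n i : R := net_first t i - net_slope t n i * t 0%N.
Definition net_map t n i s : R := net_slope t n i * s + net_intercept t n i.

Lemma net_map_first t n i : net_map t n i (t 0%N) = net_first t i.
Proof. by rewrite /net_map /net_intercept addrC subrK. Qed.

Lemma net_map_last t n i : t 0%N < t n -> net_map t n i (t n) = net_last t i.
Proof.
move=> tn; rewrite /net_map /net_intercept addrCA -mulrBr divfK.
  by rewrite addrC subrK.
by rewrite subr_eq0 gt_eqF.
Qed.

Lemma net_map_bij t n i : t 0%N < t n -> t i.-1 < t i ->
  set_bij `[t 0%N, t n] `[t i.-1, t i] (net_map t n i).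
Proof.
move=> t0n ti; have D0 : 0 < t n - t 0%N by rewrite subr_gt0.
have sD : net_slope t n i * (t n - t 0%N) = net_last t i - net_first t i.
  by rewrite /net_slope divfK// gt_eqF.
have s0 : net_slope t n i != 0.
  apply/eqP => s0; move: sD; rewrite s0 mul0r /net_last /net_first.
  by case: ifP => _; lra.
split.
- move=> s /=; rewrite !in_itv/= => /andP[s1 s2].
  have -> : net_map t n i s = net_first t i + net_slope t n i * (s - t 0%N).
    by rewrite /net_map /net_intercept; ring.
  move: sD s0; rewrite /net_last /net_first; case: ifP => _ sD s0.
    by nra.
  by nra.
- by move=> s r _ _ /addIr/(mulfI s0).
- move=> r /=; rewrite in_itv/= => /andP[r1 r2].
  exists (t 0%N + (r - net_first t i) / net_slope t n i); last first.
    by rewrite /net_map /net_intercept; field.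
  rewrite /= in_itv/=; set q := (_ / _).
  have qE : net_slope t n i * q = r - net_first t i by rewrite /q; field.
  move: sD qE; rewrite /net_last /net_first.
  case: ifP => _ sD qE; apply/andP; split; nra.
Qed.

End net_map.

Section alpha_fractal.
Context {R : realType} (N M : nat) (x y : nat -> R).
Local Notation C := (Crectangle (x 0%N) (x N) (y 0%N) (y M)).

Definition fractal_F (alpha f Lf : C) (i j : nat) (p : R * R * R) : R :=
  let q := (net_map x N i p.1.1, net_map y M j p.1.2) in
  alpha q * p.2 + f q - alpha q * Lf p.1.

Definition fractal_W (alpha f Lf : C) (i j : nat) (p : R * R * R) : R * R * R :=
  (net_map x N i p.1.1, net_map y M j p.1.2, fractal_F alpha f Lf i j p).

Definition rect_graph (g : C) : set (R * R * R) :=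
  [set (p, g p) | p in rect (x 0%N) (x N) (y 0%N) (y M)].

End alpha_fractal.

Arguments fractal_F {R} N M x y alpha f Lf i j p.
Arguments fractal_W {R} N M x y alpha f Lf i j p.
Arguments rect_graph {R} N M x y g.

(* Main.v *)
Require Import Defs.
From mathcomp Require Import all_boot all_order all_algebra.
From mathcomp Require Import all_classical all_reals all_analysis.
From mathcomp Require Import ring lra.

Import Order.TTheory GRing.Theory Num.Theory.
Import numFieldNormedType.Exports.

Local Open Scope classical_set_scope.
Local Open Scope ring_scope.

(** The maps of consecutive cells agree at the node that the cells share,
    because their orientations alternate: both send the same endpoint of the
    whole interval to it.  Hence the inverses of the maps of all cells glue to a
    continuous folding map [Q] of the rectangle onto itself, with
    [Q (u_i s, v_j r) = (s, r)].  For a continuous [g] put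
    [T g = f + alpha * ((g - L f) \o Q)], the Read-Bajraktarevic operator.

    - The union of the images of the graph of [g] under the [W_ij] is exactly
      the graph of [T g] ([fractal_W_graph]).  As a graph determines its
      function, the self-referential equation for [g] says that [g] is a fixed
      point of [T].
    - [T] is Lipschitz with constant [`|alpha| < 1] ([rb_lipschitz]), and the
      continuous functions form a Banach space, so that [T] has exactly one
      fixed point ([rb_fixpoint]).  This gives existence and uniqueness.
    - The fixed point interpolates [f] ([rb_fixpoint_node]): [Q] sends a node to
      a corner, where [L f = f], so that [h = g - f] satisfies
      [h c = alpha c * h (Q c)] at every node [c].  The second iterate of [Q]
      sends a node to a corner fixed by [Q], and there the equation and
      [`|alpha| < 1] force [h] to vanish; going back along the two steps, [h]
      vanishes at [c]. *)

(** * Folding an interval along a net *)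

Section net_fold.
Context {R : realType} (t : nat -> R) (n : nat).
Hypothesis t_net : forall i, (i < n)%N -> t i < t i.+1.

Lemma net_le i j : (i <= j)%N -> (j <= n)%N -> t i <= t j.
Proof.
move=> + jn; elim: j jn => [|j IHj] jn; first by rewrite leqn0 => /eqP ->.
rewrite leq_eqVlt => /predU1P[->//|ij].
by rewrite (le_trans (IHj (ltnW jn) ij))// ltW// t_net.
Qed.

Lemma net_first_lt_last : (0 < n)%N -> t 0%N < t n.
Proof. by move=> n0; rewrite (lt_le_trans (t_net _ n0))// net_le. Qed.

Lemma net_cover s : (0 < n)%N -> `[t 0%N, t n]%classic s ->
  exists2 i, (0 < i <= n)%N & `[t i.-1, t i]%classic s.
Proof.
rewrite /= in_itv/= => n0 /andP[s0 sn].
have exP : exists i, (0 < i)%N && (s <= t i) by exists n; rewrite n0.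
case: (ex_minnP exP) => i /andP[i0 si] imin; exists i.
  by rewrite i0 imin// n0.
rewrite /= in_itv/= si andbT; case: i i0 si imin => // -[|i] _ _ imin //=.
have [//|/ltW sti] := leP (t i.+1) s.
by have := imin i.+1 sti; rewrite ltnn.
Qed.

Lemma net_map_in i s : (0 < i <= n)%N ->
  `[t 0%N, t n]%classic s -> `[t 0%N, t n]%classic (net_map t n i s).
Proof.
case: i => // i /= i_n Ks.
have D0 := net_first_lt_last (leq_ltn_trans (leq0n i) i_n).
have [+ _ _] := net_map_bij (i := i.+1) D0 (t_net i i_n).
move=> /(_ _ Ks); rewrite /= !in_itv/= => /andP[ti ti1].
rewrite (le_trans (net_le 0 i _ _) ti) ?(ltnW i_n)//=.
by rewrite (le_trans ti1)// net_le.
Qed.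

(** The zigzag that runs over the whole interval once on each cell, upwards and
    downwards in turn.  The summand of index [i] is constant outside the cell
    from [t i] to [t i.+1], so that continuity is visible in the formula and no
    gluing of pieces is needed. *)
Definition net_fold (s : R) : R :=
  t 0%N + \sum_(i < n) (-1) ^+ i * ((t n - t 0%N) / (t i.+1 - t i)) *
                       (Num.min (Num.max s (t i)) (t i.+1) - t i).

Lemma net_fold_continuous : continuous net_fold.
Proof.
move=> s; apply: cvgD; first exact: cvg_cst.
apply: cvg_big => [|i _]; first exact: add_continuous.
apply: cvgM; first exact: cvg_cst.
apply: cvgB; last exact: cvg_cst.
apply: (@continuous_min _ _ (id \max cst (t i)) (cst (t i.+1))).
  apply: (@continuous_max _ _ id (cst (t i))); first exact: cvg_id.
  exact: cvg_cst.
exact: cvg_cst.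
Qed.

(** To the left of the cell the increments of the completed cells alternate in
    sign, so that they sum to nothing or to one full length, according to the
    parity of [k]; the summands to the right of the cell vanish. *)
Lemma net_foldE k s : (k < n)%N -> t k <= s <= t k.+1 ->
  net_fold s = t 0%N + (t n - t 0%N) *
    ((odd k)%:R + (-1) ^+ k * ((s - t k) / (t k.+1 - t k))).
Proof.
move=> kn /andP[ks sk].
pose F i := (-1) ^+ i * ((t n - t 0%N) / (t i.+1 - t i)) *
  (Num.min (Num.max s (t i)) (t i.+1) - t i).
rewrite /net_fold -(big_mkord xpredT F).
rewrite (big_cat_nat _ (n := k)) ?(ltnW kn)//=.
rewrite (big_cat_nat _ (n := k.+1) (m := k))//= big_nat1.
have -> : \sum_(k.+1 <= i < n) F i = 0.
  rewrite big_nat_cond big1// => i /andP[/andP[ki i_n] _].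
  have si : s <= t i by rewrite (le_trans sk)// net_le// ltnW.
  by rewrite /F max_r// min_l ?subrr ?mulr0// ltW// t_net.
have below j : (j <= k)%N ->
    \sum_(0 <= i < j) F i = (t n - t 0%N) * (odd j)%:R.
  elim: j => [|j IHj] jk; first by rewrite big_nil mulr0.
  rewrite big_nat_recr//= IHj ?(ltnW jk)//.
  have js : t j.+1 <= s by rewrite (le_trans _ ks)// net_le// ltnW.
  have j1 : t j < t j.+1 by rewrite t_net// (ltn_trans jk).
  rewrite /F max_l ?min_r//; last by rewrite (le_trans _ js)// ltW.
  rewrite -mulrA divfK ?subr_eq0 ?gt_eqF// -signr_odd.
  by case: (odd j); rewrite /= ?expr1 ?expr0; ring.
rewrite below// /F max_l// min_l//; ring.
Qed.

(** One continuous map inverts the maps of all cells at once: the alternating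
    signs in the zigzag match the alternating orientations of the cell maps. *)
Lemma net_fold_map i s : (0 < i <= n)%N -> `[t 0%N, t n]%classic s ->
  net_fold (net_map t n i s) = s.
Proof.
case: i => // k /= kn Ks.
have D0 := net_first_lt_last (leq_ltn_trans (leq0n k) kn).
have [+ _ _] := net_map_bij (i := k.+1) D0 (t_net k kn).
move=> /(_ _ Ks); rewrite /= in_itv/= => /(net_foldE k _ kn) ->.
have := t_net k kn; have := D0.
rewrite /net_map /net_intercept /net_slope /net_first /net_last/= -signr_odd.
rewrite -(subr_gt0 (t 0%N)) -(subr_gt0 (t k)) => /lt0r_neq0 ? /lt0r_neq0 ?.
by case: (odd k) => /=; rewrite ?expr1 ?expr0; field; apply/andP.
Qed.

Lemma net_fold_node i : (0 < n)%N -> (i <= n)%N ->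
  net_fold (t i) = t (if odd i then n else 0%N).
Proof.
move=> n0 i_n; have D0 := net_first_lt_last n0.
have K0 : `[t 0%N, t n]%classic (t 0%N) by rewrite /= in_itv/= lexx ltW.
have Kn : `[t 0%N, t n]%classic (t n) by rewrite /= in_itv/= lexx ltW.
case: i i_n => [_|i i_n].
  by have := net_fold_map 1 (t 0%N) n0 K0; rewrite net_map_first.
have [oi|ei] := boolP (odd i.+1).
  have := net_fold_map i.+1 (t n) i_n Kn.
  by rewrite net_map_last// /net_last oi.
have := net_fold_map i.+1 (t 0%N) i_n K0.
by rewrite net_map_first /net_first (negbTE ei).
Qed.

(** One fold brings a node to an endpoint.  For odd [n] both endpoints are
    fixed; for even [n] the last endpoint is sent to the first one, which is
    fixed, and this is why a second fold is needed to reach a fixed endpoint. *)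
Lemma net_fold_node3 i : (0 < n)%N -> (i <= n)%N ->
  net_fold (net_fold (net_fold (t i))) = net_fold (net_fold (t i)).
Proof.
move=> n0 i_n; rewrite (net_fold_node i)//.
have /= f0 := net_fold_node 0 n0 (leq0n n).
have fn := net_fold_node n n0 (leqnn n).
by case: (odd i); case: (odd n) fn => fn; rewrite ?(f0, fn).
Qed.

End net_fold.

(** * The operator and its fixed point *)

Section read_bajraktarevic.
Context {R : realType} (N M : nat) (x y : nat -> R).
Hypotheses (N0 : (0 < N)%N) (M0 : (0 < M)%N).
Hypothesis x_net : forall i, (i < N)%N -> x i < x i.+1.
Hypothesis y_net : forall j, (j < M)%N -> y j < y j.+1.
Local Notation K := (rect (x 0%N) (x N) (y 0%N) (y M)).
Local Notation C := (Crectangle (x 0%N) (x N) (y 0%N) (y M)).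

Definition cell_map (i j : nat) (p : R * R) : R * R :=
  (net_map x N i p.1, net_map y M j p.2).

Definition rect_fold (p : R * R) : R * R :=
  (net_fold x N p.1, net_fold y M p.2).

Lemma cell_map_in i j p : (0 < i <= N)%N -> (0 < j <= M)%N ->
  K p -> K (cell_map i j p).
Proof. by move=> iN jM [p1 p2]; split; exact: net_map_in. Qed.

Lemma rect_fold_cell i j p : (0 < i <= N)%N -> (0 < j <= M)%N ->
  K p -> rect_fold (cell_map i j p) = p.
Proof.
by case: p => s r iN jM [p1 p2]; rewrite /rect_fold /= !net_fold_map.
Qed.

Lemma rect_cell_cover q : K q -> exists ij : nat * nat,
  [/\ (0 < ij.1 <= N)%N, (0 < ij.2 <= M)%N &
      exists2 p, K p & cell_map ij.1 ij.2 p = q].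
Proof.
case: q => s r [/= Ks Kr].
have [i iN si] := net_cover x N s N0 Ks.
have [j jM rj] := net_cover y M r M0 Kr.
exists (i, j); split=> //=.
have step (t : nat -> R) n k : (forall i, (i < n)%N -> t i < t i.+1) ->
    (0 < k <= n)%N -> t k.-1 < t k.
  by move=> tn; case: k => // k /= kn; exact: tn.
have [_ _ /(_ _ si)[s' Ks' s's]] :=
  net_map_bij (net_first_lt_last _ _ x_net N0) (step x N i x_net iN).
have [_ _ /(_ _ rj)[r' Kr' r'r]] :=
  net_map_bij (net_first_lt_last _ _ y_net M0) (step y M j y_net jM).
by exists (s', r') => //; rewrite /cell_map /= s's r'r.
Qed.

Lemma rect_fold_in q : K q -> K (rect_fold q).
Proof.
by move=> /rect_cell_cover[[i j] [iN jM [p Kp <-]]]; rewrite rect_fold_cell.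
Qed.

Lemma rect_fold_continuous : continuous rect_fold.
Proof.
move=> [s r].
apply: (@cvg_pair _ _ _ _ (nbhs (net_fold x N s)) (nbhs (net_fold y M r))).
  by apply: (cvg_comp fst (net_fold x N)); [exact: cvg_fst|
    exact: net_fold_continuous].
by apply: (cvg_comp snd (net_fold y M)); [exact: cvg_snd|
  exact: net_fold_continuous].
Qed.

(** Continuity of [g] is only known within the rectangle, which is why the fold
    has to preserve the rectangle. *)
Lemma comp_rect_fold_continuous (g : C) :
  {within K, continuous (g \o rect_fold)}.
Proof.
apply/subspace_continuousP => p Kp.
have cg := @Crectangle_cont _ _ _ _ _ g.
have {}cg := (subspace_continuousP _ _).1 cg _ (rect_fold_in _ Kp).
apply: (cvg_comp rect_fold g _ cg) => A /(rect_fold_continuous p) nA.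
by apply: (@filterS _ (nbhs p) _ _ _ _ nA) => q Aq Kq; exact/Aq/rect_fold_in.
Qed.

Lemma rect_graph_inj : injective (@rect_graph R N M x y).
Proof.
move=> g h gh; apply: CrectangleP => p Kp.
have : rect_graph N M x y h (p, g p) by rewrite -gh; exists p.
by case=> q _ [-> ->].
Qed.

Variables f Lf alpha : C.

Definition rb_fun (g : C) (p : R * R) : R :=
  f p + alpha p * (g (rect_fold p) - Lf (rect_fold p)).

Lemma rb_fun_cont g : rb_fun g \in rect_cont (x 0%N) (x N) (y 0%N) (y M).
Proof.
apply/rect_contP; split=> [p|p Kp].
  apply: cvgD; first exact: Crectangle_cont.
  apply: cvgM; first exact: Crectangle_cont.
  exact: (comp_rect_fold_continuous (g - Lf)).
by rewrite /rb_fun (Crectangle_out f Kp) (Crectangle_out alpha Kp) mul0r addr0.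
Qed.

(** The Read-Bajraktarevic operator. *)
Definition rb (g : C) : C := MkCrectangle (rb_fun_cont g).

Lemma rbE g p : rb g p = f p + alpha p * (g (rect_fold p) - Lf (rect_fold p)).
Proof. by []. Qed.

Lemma rb_lipschitz g h : `|rb g - rb h| <= `|alpha| * `|g - h|.
Proof.
apply: Crectangle_norm_le => [|p _]; first exact: mulr_ge0.
have -> : (rb g - rb h) p = alpha p * (g - h) (rect_fold p).
  have BE (u v : C) q : (u - v) q = u q - v q by [].
  by rewrite !BE !rbE; ring.
by rewrite normrM ler_pM// Crectangle_norm_ge.
Qed.

(** On the cell [(i, j)] the inverse of [cell_map i j] is the fold, so that
    solving [q = cell_map i j p] for [p] turns the last coordinate of [W_ij]
    into [rb g q]; and the cells cover the rectangle. *)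
Lemma fractal_W_graph g :
  \bigcup_(ij in [set ij : nat * nat | (1 <= ij.1 <= N)%N /\
                                       (1 <= ij.2 <= M)%N])
    (fractal_W N M x y alpha f Lf ij.1 ij.2 @` rect_graph N M x y g)
  = rect_graph N M x y (rb g).
Proof.
have WE i j p : (0 < i <= N)%N -> (0 < j <= M)%N -> K p ->
    fractal_W N M x y alpha f Lf i j (p, g p) =
    (cell_map i j p, rb g (cell_map i j p)).
  move=> iN jM Kp; congr pair.
  by rewrite rbE rect_fold_cell// /fractal_F /= -/(cell_map i j p); ring.
apply/seteqP; split=> [_ [[i j] [/= iN jM]] [_ [p Kp <-] <-]|_ [q Kq <-]].
  by rewrite WE//; exists (cell_map i j p) => //; exact: cell_map_in.
have [[i j] [iN jM [p Kp <-]]] := rect_cell_cover _ Kq.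
by exists (i, j) => //; exists (p, g p); [exists p|rewrite WE].
Qed.

Hypothesis alpha_lt1 : `|alpha| < 1.

Lemma rb_fixpoint : exists! g, rb g = g.
Proof.
have ctr : is_contraction (totalfun rb).
  exists (NngNum (normr_ge0 alpha)); split=> // -[g h] _.
  exact: rb_lipschitz.
have [||g _ gE] := banach_fixed_point ctr; [exact: closedT|by exists 0|].
exists g; split=> [//|h hE].
exact: (contraction_fixpoint_unique ctr).
Qed.

Hypothesis Lf_corner : forall i j, i \in [:: 0%N; N] -> j \in [:: 0%N; M] ->
  Lf (x i, y j) = f (x i, y j).

Lemma rb_fixpoint_node g i j : rb g = g -> (i <= N)%N -> (j <= M)%N ->
  g (x i, y j) = f (x i, y j).
Proof.
move=> gE iN jM; pose h p := g p - f p.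
pose node p := exists k l, [/\ (k <= N)%N, (l <= M)%N & p = (x k, y l)].
have node_fold p : node p -> node (rect_fold p).
  move=> [k [l [kN lM ->]]]; rewrite /rect_fold /= !net_fold_node//.
  exists (if odd k then N else 0%N), (if odd l then M else 0%N).
  by split=> //; case: ifP.
have h_fold p : node p -> h p = alpha p * h (rect_fold p).
  move=> [k [l [kN lM ->]]]; rewrite /h -{1}gE rbE addrC addKr.
  rewrite /rect_fold /= !net_fold_node//; congr (_ * _).
  by rewrite -Lf_corner//; case: ifP => _; rewrite !inE eqxx ?orbT.
pose c0 := (x i, y j); pose c1 := rect_fold c0; pose c2 := rect_fold c1.
have node0 : node c0 by exists i, j.
have node1 := node_fold _ node0; have node2 := node_fold _ node1.
have c2_fixed : rect_fold c2 = c2.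
  by rewrite /c2 /c1 /rect_fold /= !net_fold_node3.
(* At the fixed corner c2 the equation reads (1 - alpha c2) * h c2 = 0. *)
have h2 : h c2 = 0.
  have /eqP := h_fold _ node2; rewrite c2_fixed.
  rewrite -subr_eq0 -{1}[h c2]mul1r -mulrBl mulf_eq0 subr_eq0.
  move=> /predU1P[a1|/eqP//].
  have := le_lt_trans (Crectangle_norm_ge alpha c2) alpha_lt1.
  by rewrite -a1 normr1 ltxx.
have : h c0 = 0 by rewrite (h_fold _ node0) (h_fold _ node1) h2 !mulr0.
by move/eqP; rewrite subr_eq0 => /eqP.
Qed.

End read_bajraktarevic.

Theorem theorem3p1 (R : realType) (N M : nat) (x y : nat -> R)
    (N2 : (2 <= N)%N) (M2 : (2 <= M)%N)
    (x_net : forall i, (i < N)%N -> x i < x i.+1)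
    (y_net : forall j, (j < M)%N -> y j < y j.+1)
    (f : Crectangle (x 0%N) (x N) (y 0%N) (y M))
    (L : {linear Crectangle (x 0%N) (x N) (y 0%N) (y M) ->
                 Crectangle (x 0%N) (x N) (y 0%N) (y M)})
    (L_bounded : exists k : R, forall h, `|L h| <= k * `|h|)
    (Lf_neq : L f <> f)
    (Lf_corner : forall i j, i \in [:: 0%N; N] -> j \in [:: 0%N; M] ->
       L f (x i, y j) = f (x i, y j))
    (alpha : Crectangle (x 0%N) (x N) (y 0%N) (y M))
    (alpha_lt1 : `|alpha| < 1) :
  exists! g : Crectangle (x 0%N) (x N) (y 0%N) (y M),
    (forall i j, (i <= N)%N -> (j <= M)%N -> g (x i, y j) = f (x i, y j)) /\
    rect_graph N M x y g =
      \bigcup_(ij in [set ij : nat * nat | (1 <= ij.1 <= N)%N /\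
                                           (1 <= ij.2 <= M)%N])
        (fractal_W N M x y alpha f (L f) ij.1 ij.2 @` rect_graph N M x y g).
Proof.
have N0 := ltnW N2; have M0 := ltnW M2.
have WE := fractal_W_graph N M x y N0 M0 x_net y_net f (L f) alpha.
have [g [gE g_uniq]] :=
  rb_fixpoint N M x y N0 M0 x_net y_net f (L f) alpha alpha_lt1.
exists g; split=> [|h [_]].
  split=> [i j|]; last by rewrite WE gE.
  exact: (rb_fixpoint_node _ _ _ _ N0 M0 x_net y_net _ _ _ alpha_lt1 Lf_corner).
rewrite WE => /rect_graph_inj hE.
exact: g_uniq.
Qed.
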